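(* Let $n \ge 2$ be an integer and let $A_n \in \{0,1\}^{[2]^n \times [2]^{n-1}}$ be the binary single-deletion channel, i.e. $(A_n)_{x,y}=1$ if and only if $y$ can be obtained from $x$ by deleting exactly one symbol. Then \[ \kappa^*(A_n) \le \frac{2^n}{n+1}\left(1 + \frac{26}{n(n-1)}\right). \]
   Context: $[2]=\{0,1\}$ and $[2]^m$ is the set of binary strings of length $m$. For a $0/1$ matrix $A \in \{0,1\}^{X\times Y}$, $\kappa^*(A) = \min\{\mathbf{1}^T z : z \in \mathbb{R}^Y,\ z \ge \mathbf{0},\ Az \ge \mathbf{1}\}$ (entrywise inequalities), the minimum fractional output covering number. *)

(* Defs.v *)
From mathcomp Require Import all_boot all_order all_algebra.
From mathcomp Require Import all_classical all_reals.
Set Implicit Arguments. Unset Strict Implicit. Unset Printing Implicit Defensive.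
Import Order.TTheory GRing.Theory Num.Theory.
Local Open Scope ring_scope.
Local Open Scope classical_set_scope.

(* A 0/1 matrix indexed by X x Y is a boolean relation A : X -> Y -> bool. *)

(* Minimum fractional output covering number:
   kappa*(A) = min { 1^T z : z >= 0, A z >= 1 }, written as the infimum
   of the (attained) objective values of feasible z. *)
Definition kappa_star (R : realType) (X Y : finType) (A : X -> Y -> bool) : R :=
  inf [set t : R | exists z : Y -> R,
        (forall y, 0 <= z y) /\
        (forall x, 1 <= \sum_(y : Y) (A x y)%:R * z y) /\
        t = \sum_(y : Y) z y].

Definition deletion_channel (n : nat) (x : n.-tuple bool) (y : (n - 1).-tuple bool)
  : bool :=
  [exists i : 'I_n, tval y == take i x ++ drop i.+1 x].

(* Main.v *)
Require Import Defs.
From mathcomp Require Import all_boot all_order all_algebra.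
From mathcomp Require Import all_classical all_reals.
From mathcomp Require Import zify ring lra.
Import Order.TTheory GRing.Theory Num.Theory.
Local Open Scope ring_scope.

(**
Let [r] be the number of runs of a string and [u] the number of its interior
runs of length one. Every [x] has exactly [r] neighbours, so the weight [1 / r]
is a fractional cover, of total about [2 ^ n / (n - 1)]; it overcovers [x] by
about [2 u / r ^ 2], since deleting an interior run of length one removes two
runs. The weight [1 / r + h r ((r - 2) / r - u)] with
[h r = 2 / ((r - 2) (r + 2) (r + 3))] corrects this: it covers [x] with equality
at [u = 0] when all interior runs have length two, and the coverage is concave
in [u]. In terms of the sequence of flips (positions where consecutive symbols
differ), [r - 1] is the number of ones and [u] the number of adjacent pairs of
ones, so the total weight is a combination of sums
[\sum_j 'C(k, j) / ((j + a) (j + b))], which the absorption identity reduces to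
binomial moments.
*)

Ltac nonneg :=
  repeat first [ exact: ler0n | exact: ler01 | assumption
               | apply: addr_ge0 | apply: mulr_ge0 | apply: exprn_ge0
               | rewrite invr_ge0 ].

(** * The weight and its inequalities *)

Section Weight.
Variable R : realType.

(* The subtraction is truncated and [0^-1 = 0], so [slope r = 0] for [r <= 2]. *)
Definition slope (r : nat) : R := 2 / ((r - 2)%:R * (r%:R + 2) * (r%:R + 3)).

Definition weight (r u : nat) : R :=
  r%:R^-1 + slope r * ((r - 2)%:R / r%:R - u%:R).

Lemma slope_le2 r : (r <= 2)%N -> slope r = 0.
Proof. by rewrite /slope -subn_eq0 => /eqP ->; rewrite !mul0r invr0 mulr0. Qed.

Lemma slope_add3 k : slope k.+3 = 2 / ((k%:R + 1) * (k%:R + 5) * (k%:R + 6)).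
Proof.
by rewrite /slope !subSS subn0; congr (_ / _); rewrite -[k.+3]addn3 -[k.+1]addn1 !natrD; ring.
Qed.

Lemma slope3 : slope 3 = 1 / 15.
Proof. by rewrite slope_add3; field. Qed.

Lemma slope4 : slope 4 = 1 / 42.
Proof. by rewrite slope_add3; field. Qed.

Lemma slope_ge0 r : 0 <= slope r.
Proof. by rewrite /slope; nonneg. Qed.

Lemma le_weight r u v : (u <= v)%N -> weight r v <= weight r u.
Proof.
move=> uv; rewrite /weight lerD2l ler_wpM2l ?slope_ge0// lerD2l lerN2.
by rewrite ler_nat.
Qed.

(** The weight decreases in [u], so only the extreme value [u = r - 2] has to be checked. *)
Lemma weight_ge0 r u : (u <= r - 2)%N -> 0 <= weight r u.
Proof.
move=> ur; case: r ur => [|[|[|k]]] ur.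
- by rewrite /weight slope_le2// mul0r addr0 invr0.
- by rewrite /weight slope_le2// mul0r addr0 invr_ge0.
- by rewrite /weight slope_le2// mul0r addr0 invr_ge0.
apply: le_trans (le_weight _ _ _ ur).
rewrite /weight slope_add3 !subSS subn0 -[k.+3]addn3 -[k.+1]addn1 !natrD.
have k0 : 0 <= k%:R :> R by [].
set x : R := k%:R in k0 *.
set A := (X in 0 <= X).
have -> : A =
    (x ^+ 2 + 9 * x + 26) / ((x + 3) * (x + 5) * (x + 6)).
  by rewrite /A; field; rewrite ?unfold_in /=; do ?[apply/andP; split]; apply/eqP; lra.
by nonneg.
Qed.

(** Serves the deletions at the two ends of a string, which lose at most one run. *)
Lemma weight_succ r u : (0 < r)%N -> (u <= r - 2)%N -> weight r.+1 u <= weight r u.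
Proof.
case: r => [|[|[|k]]]// _; rewrite ?subn0 ?subSS ?leqn0 => ur.
- move/eqP: ur => ->; rewrite /weight !slope_le2// !mul0r !addr0.
  by rewrite lef_pV2 ?posrE// ler_nat.
- move/eqP: ur => ->; rewrite /weight (@slope_le2 2)// slope3 !subSS !subn0.
  lra.
have k0 : 0 <= k%:R :> R by [].
have ur' : u%:R <= k%:R + 1 :> R by rewrite natr1 ler_nat.
rewrite /weight !slope_add3 !subSS !subn0 -[k.+4]addn4 -[k.+3]addn3 -[k.+2]addn2 -[k.+1]addn1 !natrD.
set x : R := k%:R in k0 ur' *; set v : R := u%:R in ur' *.
rewrite -subr_ge0.
have v0 : 0 <= x + 1 - v by lra.
(* The difference is affine in [u]. Written in the slack [w] of [u <= r - 2], both of its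
   coefficients are nonnegative. *)
set w := x + 1 - v in v0.
have -> : v = x + 1 - w by rewrite /w; ring.
set A := (X in 0 <= X).
have -> : A = (x ^+ 4 + 14 * x ^+ 3 + 89 * x ^+ 2 + 264 * x + 256) /
     ((x + 3) * (x + 2) * (x + 4) * (x + 5) * (x + 6) * (x + 7))
   + w * (2 * (3 * x + 9) / ((x + 1) * (x + 2) * (x + 5) * (x + 6) * (x + 7))).
  by rewrite /A; field; rewrite ?unfold_in /=; do ?[apply/andP; split]; apply/eqP; lra.
by nonneg.
Qed.

(* For [b = r - 2 - u] the right side is concave in [u] and equals 1 at [u = 0],
   so only [u = r - 2] matters. *)
Lemma weight_cover r u b : (1 < r)%N -> (u + b <= r - 2)%N ->
  1 <= u%:R * weight (r - 2) (u - 1) + (r%:R - u%:R) * weight r u - b%:R * slope r.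
Proof.
(* The rational form of [slope (r - 2)] needs [r >= 5]; for smaller [r] truncation makes it 0, and
   each case is checked apart. *)
case: r => [|[|[|[|[|k]]]]]// _; rewrite !subSS ?subn0 => ub.
- have [-> ->] : u = 0%N /\ b = 0%N by lia.
  rewrite /weight !slope_le2//; lra.
- have [[-> b1]|[-> ->]] : (u = 0 /\ b <= 1)%N \/ u = 1%N /\ b = 0%N by lia.
    have b1' : b%:R <= 1 :> R by rewrite (ler_nat _ _ 1).
    rewrite /weight slope3 !subSS !subn0; lra.
  rewrite /weight slope3 !subSS !subn0 (@slope_le2 1)//; lra.
- have h2 : slope 2 = 0 by rewrite slope_le2.
  have [[-> b1]|[[-> b1]|[-> ->]]] : (u = 0 /\ b <= 2)%N \/ (u = 1 /\ b <= 1)%N \/ u = 2%N /\ b = 0%N by lia.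
  + have b1' : b%:R <= 2 :> R by rewrite (ler_nat _ _ 2).
    rewrite /weight slope4 !subSS !subn0; lra.
  + have b1' : b%:R <= 1 :> R by rewrite (ler_nat _ _ 1).
    rewrite /weight slope4 !subSS !subn0 h2; lra.
  + rewrite /weight slope4 !subSS !subn0 h2; lra.
have k0 : 0 <= k%:R :> R by [].
have u0 : 0 <= u%:R :> R by [].
have ub' : u%:R + b%:R <= k%:R + 3 :> R by rewrite -!natrD ler_nat; lia.
have b0 : 0 <= b%:R :> R by [].
(* At [u = 0] the truncated [u - 1] differs from the real one, but the factor [u] hides this. *)
have -> : u%:R * weight k.+3 (u - 1) = u%:R * (k.+3%:R^-1 + slope k.+3 * (k.+1%:R / k.+3%:R - (u%:R - 1))).
  case: u {ub u0 ub'} => [|u]; first by rewrite !mul0r.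
  have -> : u.+1%:R - 1 = u%:R :> R by rewrite -natr1 addrK.
  by rewrite subn1 /= /weight !subSS subn0.
have k5 : k.+4.+1%:R = k%:R + 5 :> R by rewrite addrC -natrD.
rewrite /weight !slope_add3 !subSS !subn0 k5 -[k.+3]addn3 -[k.+2]addn2 -[k.+1]addn1 !natrD.
set x : R := k%:R in k0 ub' *; set v : R := u%:R in u0 ub' *; set c : R := b%:R in b0 ub' *.
rewrite -subr_ge0.
set A := (X in 0 <= X).
have w0 : 0 <= x + 3 - v - c by lra.
have w1 : 0 <= x + 3 - v by lra.
(* A concave function of [v] that vanishes at 0, plus [slope r] times the slack in
   [u + b <= r - 2]. *)
have -> : A = v * (2 * (x ^+ 3 + 24 * x ^+ 2 + 115 * x + 8) /
     ((x + 5) * (x + 3) * (x + 7) * (x + 8) * (x + 1) * (x + 6)) +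
   (x + 3 - v) * (2 * (6 * x ^+ 2 + 60 * x + 138) /
    ((x + 1) * (x + 5) * (x + 6) * (x + 3) * (x + 7) * (x + 8))))
   + (x + 3 - v - c) * (2 / ((x + 3) * (x + 7) * (x + 8))).
  by rewrite /A; field; rewrite ?unfold_in /=; do ?[apply/andP; split]; apply/eqP; lra.
by nonneg.
Qed.

End Weight.

(** * Sums over binary strings and binomial sums *)

Section BinarySums.
Variable R : realType.

Fixpoint bsum (k : nat) (F : seq bool -> R) : R :=
  if k is k'.+1 then bsum k' (fun s => F (true :: s)) + bsum k' (fun s => F (false :: s))
  else F [::].

Lemma eq_bsum k F G : F =1 G -> bsum k F = bsum k G.
Proof. by elim: k F G => [|k IH] F G FG /=; [exact: FG | congr (_ + _); apply: IH => s]. Qed.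

Lemma bsumE k (F : seq bool -> R) : \sum_(t : k.-tuple bool) F t = bsum k F.
Proof.
elim: k F => [|k IH] F /=.
  rewrite (big_pred1 [tuple]) // => t.
  by apply/esym/eqP/val_inj; case: t => [[]].
rewrite -!IH.
rewrite (reindex (fun p : bool * k.-tuple bool => [tuple of p.1 :: p.2])) /=; last first.
  exists (fun t => (thead t, [tuple of behead t])) => [[b t] _|t _] /=.
    by rewrite theadE; congr (_, _); apply: val_inj.
  by rewrite [in RHS](tuple_eta t).
by rewrite -(pair_big xpredT xpredT (fun b (t : k.-tuple bool) => F (b :: t))) /= big_bool.
Qed.

Lemma bsumD k F G : bsum k (fun s => F s + G s) = bsum k F + bsum k G.
Proof. by elim: k F G => [|k IH] F G //=; rewrite !IH addrACA. Qed.

(** For a fixed preceding symbol [a], taking flips is a bijection of the strings of length [k]. *)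
Lemma bsum_pairmap_addb k a F : bsum k (fun s => F (pairmap addb a s)) = bsum k F.
Proof.
elim: k a F => [|k IH] a F //=.
rewrite (IH true (fun s => F (a (+) true :: s))) (IH false (fun s => F (a (+) false :: s))).
by case: a => //=; rewrite addrC.
Qed.

(* [binsum k f = \sum_(j < k.+1) 'C(k, j) * f j] *)
Fixpoint binsum (k : nat) (f : nat -> R) : R :=
  if k is k'.+1 then binsum k' f + binsum k' (fun j => f j.+1) else f 0%N.

Lemma eq_binsum k f g : f =1 g -> binsum k f = binsum k g.
Proof. by elim: k f g => [|k IH] f g fg /=; [exact: fg | congr (_ + _); apply: IH => s]. Qed.

Lemma binsumD k f g : binsum k (fun j => f j + g j) = binsum k f + binsum k g.
Proof. by elim: k f g => [|k IH] f g //=; rewrite !IH addrACA. Qed.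

Lemma binsumZ k c f : binsum k (fun j => c * f j) = c * binsum k f.
Proof. by elim: k f => [|k IH] f //=; rewrite !IH mulrDr. Qed.

Lemma ler_binsum k f g : (forall j, f j <= g j) -> binsum k f <= binsum k g.
Proof. by elim: k f g => [|k IH] f g fg //=; apply: lerD; apply: IH. Qed.

Lemma bsum_count k f : bsum k (fun s => f (count id s)) = binsum k f.
Proof.
elim: k f => [|k IH] f //=; rewrite addrC; congr (_ + _).
  by rewrite -IH; apply: eq_bsum => s; rewrite add0n.
by rewrite -(IH (fun j => f j.+1)); apply: eq_bsum => s; rewrite add1n.
Qed.

(** Summed form of [j * 'C(k + 1, j) = (k + 1) * 'C(k, j - 1)]. *)
Lemma binsum_absorb k f : binsum k.+1 (fun j => j%:R * f j) = k.+1%:R * binsum k (fun j => f j.+1).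
Proof.
elim: k f => [|k IH] f; first by rewrite /= mul0r add0r.
have E : binsum k.+1 (fun j => j.+1%:R * f j.+1) =
  binsum k.+1 (fun j => j%:R * f j.+1) + binsum k.+1 (fun j => f j.+1).
  by rewrite -binsumD; apply: eq_binsum => j; rewrite -natr1; ring.
rewrite [LHS](_ : _ = binsum k.+1 (fun j => j%:R * f j) + binsum k.+1 (fun j => j.+1%:R * f j.+1)) //.
rewrite E !IH -[k.+2%:R]natr1 /=; ring.
Qed.

Lemma binsum_const k c : binsum k (fun=> c) = 2 ^+ k * c.
Proof. by elim: k => [|k IH] /=; rewrite ?expr0 ?mul1r// IH exprS; ring. Qed.

Lemma binsum_eq0 k : binsum k (fun j => (j == 0%N)%:R) = 1.
Proof. by elim: k => [|k IH] //=; rewrite IH binsum_const mulr0 addr0. Qed.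

Lemma binsum_eq1 k : binsum k (fun j => (j == 1%N)%:R) = k%:R.
Proof.
case: k => [|k] //.
rewrite (@eq_binsum _ _ (fun j => j%:R * (j == 1%N)%:R)); last first.
  by move=> [|[|j]]; rewrite /= ?mulr0 ?mul1r ?mulr1.
by rewrite binsum_absorb binsum_eq0 mulr1.
Qed.

Lemma binsum_absorb3 k f :
  binsum k.+3 (fun j => j%:R * ((j%:R - 1) * ((j%:R - 2) * f j))) =
  (k%:R + 3) * (k%:R + 2) * (k%:R + 1) * binsum k (fun j => f j.+3).
Proof.
rewrite binsum_absorb.
rewrite (@eq_binsum _ _ (fun j => j%:R * ((j%:R - 1) * f j.+1))); last first.
  by move=> j; rewrite -natr1; ring.
rewrite binsum_absorb.
rewrite (@eq_binsum _ _ (fun j => j%:R * f j.+2)); last first.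
  by move=> j; rewrite -natr1; ring.
by rewrite binsum_absorb -[k.+3]addn3 -[k.+2]addn2 -[k.+1]addn1 !natrD; ring.
Qed.

End BinarySums.

(** * Flip sequences and the total weight *)

Fixpoint adj (d : seq bool) : nat :=
  if d is a :: d' then ((a && head false d') + adj d')%N else 0%N.

Definition flips (x : seq bool) : seq bool :=
  if x is a :: s then pairmap addb a s else [::].

Section Total.
Variable R : realType.
Local Notation bsum := (@bsum R).
Local Notation binsum := (@binsum R).

Definition cover_weight (y : seq bool) : R :=
  weight R (count id (flips y)).+1 (adj (flips y)).

(** Each of the [k] pairs of adjacent places holds two ones in ['C(k - 1, i)] strings with [i + 2]
    ones; absorption turns [k * 'C(k - 1, i)] into [(i + 1) * 'C(k, i + 1)]. *)
Lemma bsum_adj k (f : nat -> R) :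
  bsum k.+1 (fun s => (adj s)%:R * f (count id s)) = binsum k (fun j => j%:R * f j.+1).
Proof.
elim: k f => [|k IH] f; first by rewrite /= !mul0r addr0.
rewrite [LHS](_ : _ = bsum k.+1 (fun s => (head false s)%:R * f (count id s).+1)
   + bsum k.+1 (fun s => (adj s)%:R * f (count id s).+1)
   + bsum k.+1 (fun s => (adj s)%:R * f (count id s))); last first.
  rewrite -bsumD -[LHS]/(bsum k.+1 _ + bsum k.+1 _); congr (_ + _); apply: eq_bsum => s.
    by rewrite /= add1n natrD mulrDl.
have IH1 : bsum k.+1 (fun s => (adj s)%:R * f (count id s).+1) =
  binsum k (fun j => j%:R * f j.+2) := IH (fun j => f j.+1).
rewrite IH1 IH.
have -> : bsum k.+1 (fun s => (head false s)%:R * f (count id s).+1) = binsum k (fun j => f j.+2).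
  rewrite /= -[RHS]addr0; congr (_ + _).
    by rewrite -(@bsum_count R k (fun j => f j.+2)); apply: eq_bsum => s; rewrite mul1r add1n.
  rewrite (@eq_bsum _ _ _ (fun=> 0)); last by move=> s; rewrite mul0r.
  by elim: (k) => //= i ->; rewrite addr0.
rewrite /= addrC; congr (_ + _).
rewrite -binsumD; apply: eq_binsum => j; rewrite -[j.+1%:R]natr1; ring.
Qed.

Lemma bsum_flips k F : bsum k.+1 (fun y => F (flips y)) = 2 * bsum k F.
Proof. by rewrite /= !bsum_pairmap_addb; ring. Qed.

Lemma binsum_id k : binsum k.+1 (fun j => j%:R) = (k%:R + 1) * 2 ^+ k.
Proof.
rewrite (@eq_binsum _ _ _ (fun j => j%:R * 1)); last by move=> j; rewrite mulr1.
by rewrite binsum_absorb binsum_const mulr1 natr1.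
Qed.

Lemma binsum_absorb2 k f :
  binsum k.+2 (fun j => j%:R * ((j%:R - 1) * f j)) = (k%:R + 2) * (k%:R + 1) * binsum k (fun j => f j.+2).
Proof.
rewrite binsum_absorb.
rewrite (@eq_binsum _ _ _ (fun j => j%:R * f j.+1)); last first.
  by move=> j; rewrite -natr1; ring.
by rewrite binsum_absorb -[k.+2]addn2 -[k.+1]addn1 !natrD; ring.
Qed.

Lemma eq01_or_ge2 (j : nat) : (j == 0%N) || (j == 1%N) \/ 2 <= j%:R :> R.
Proof. by case: j => [|[|j]]; [left|left|right; rewrite (ler_nat _ 2)]. Qed.

(** The summand is [2 / (j (j - 1))] shifted by three. Three absorptions supply a falling factorial
    that clears the denominator and leaves [2 (j - 2)]. *)
Lemma binsum_inv23 k :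
  (k%:R + 5) * (k%:R + 4) * (k%:R + 3) * binsum k.+2 (fun j => 2 / ((j%:R + 2) * (j%:R + 3)))
  = 2 * (k%:R + 5) * (16 * 2 ^+ k) - 4 * (32 * 2 ^+ k) + 4 + 2 * (k%:R + 5).
Proof.
have := @binsum_absorb3 R k.+2 (fun j => 2 / (j%:R * (j%:R - 1))).
have k2 : k.+2%:R = k%:R + 2 :> R by rewrite addrC -natrD.
have k4 : k.+4%:R = k%:R + 4 :> R by rewrite addrC -natrD.
rewrite k2.
rewrite (@eq_binsum _ k.+2 _
  (fun j => 2 / ((j%:R + 2) * (j%:R + 3)))); last first.
  by move=> j /=; congr (_ / _); rewrite -[j.+3]addn3 natrD; ring.
(* At [j = 0] and [j = 1] the left side is 0 and [2 j - 4] is not; the indicators make up for it. *)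
rewrite (@eq_binsum _ k.+4.+1 _ (fun j => 2 * j%:R + (- 4 + (4 * (j == 0%N)%:R + 2 * (j == 1%N)%:R)))); last first.
  move=> j; case: (eq01_or_ge2 j) => [/orP [] /eqP -> /=|j2].
  - by ring.
  - by ring.
  have -> : (j == 0%N) = false by apply/eqP => j0; rewrite j0 in j2; lra.
  have -> : (j == 1%N) = false by apply/eqP => j0; rewrite j0 in j2; lra.
  by rewrite /=; field; rewrite ?unfold_in /=; do ?[apply/andP; split]; apply/eqP; lra.
rewrite !binsumD !binsumZ binsum_id binsum_const binsum_eq0 binsum_eq1.
have k5 : k.+4.+1%:R = k%:R + 5 :> R by rewrite addrC -natrD.
rewrite k4 k5 !exprS => E.
have -> : (k%:R + 5) * (k%:R + 4) * (k%:R + 3) = (k%:R + 2 + 3) * (k%:R + 2 + 2) * (k%:R + 2 + 1) :> R by ring.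
by rewrite -E; ring.
Qed.

(** Five absorptions, three and then two, clear the denominator. A lower bound suffices, since this
    sum enters the total with a minus sign. *)
Lemma binsum_inv45 k :
  2 * ((k%:R + 5) * (k%:R + 4) * (k%:R + 3) * (4 * 2 ^+ k)
       - 6 * ((k%:R + 5) * (k%:R + 4) * (8 * 2 ^+ k))
       + 18 * ((k%:R + 5) * (16 * 2 ^+ k)) - 24 * (32 * 2 ^+ k))
  <= (k%:R + 5) * (k%:R + 4) * (k%:R + 3) * (k%:R + 2) * (k%:R + 1)
       * binsum k (fun j => 2 / ((j%:R + 4) * (j%:R + 5))).
Proof.
have k2 : k.+2%:R = k%:R + 2 :> R by rewrite addrC -natrD.
have k3 : k.+3%:R = k%:R + 3 :> R by rewrite addrC -natrD.
have k4 : k.+4%:R = k%:R + 4 :> R by rewrite addrC -natrD.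
(* The factors [(j - 3) (j - 4)] become [j (j - 1)] after the shift by three, ready for two more
   absorptions. *)
pose f j : R := (j%:R - 3) * (j%:R - 4) * (2 / (j%:R * (j%:R - 1))).
have := @binsum_absorb3 R k.+2 f.
rewrite k2 (@eq_binsum _ k.+2 (fun j => f j.+3)
   (fun j => j%:R * ((j%:R - 1) * (2 / ((j%:R + 2) * (j%:R + 3)))))); last first.
  move=> j; rewrite /f -[j.+3]addn3 natrD.
  have j0 : 0 <= j%:R :> R by [].
  by field; rewrite ?unfold_in /=; do ?[apply/andP; split]; apply/eqP; lra.
rewrite (binsum_absorb2 k) => E.
rewrite (@eq_binsum _ k _ (fun j => 2 / ((j%:R + 4) * (j%:R + 5)))) in E; last first.
  by move=> j /=; congr (_ / _); rewrite -[j.+2]addn2 natrD; ring.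
have -> : (k%:R + 5) * (k%:R + 4) * (k%:R + 3) * (k%:R + 2) * (k%:R + 1)
       * binsum k (fun j => 2 / ((j%:R + 4) * (j%:R + 5))) =
  (k%:R + 2 + 3) * (k%:R + 2 + 2) * (k%:R + 2 + 1) * ((k%:R + 2) * (k%:R + 1)
       * binsum k (fun j => 2 / ((j%:R + 4) * (j%:R + 5)))) by ring.
rewrite -E.
have -> : 2 * ((k%:R + 5) * (k%:R + 4) * (k%:R + 3) * (4 * 2 ^+ k)
       - 6 * ((k%:R + 5) * (k%:R + 4) * (8 * 2 ^+ k))
       + 18 * ((k%:R + 5) * (16 * 2 ^+ k)) - 24 * (32 * 2 ^+ k)) =
  binsum k.+4.+1 (fun j => 2 * (j%:R * ((j%:R - 1) * ((j%:R - 2) * 1)))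
     + (- 12 * (j%:R * ((j%:R - 1) * 1)) + (36 * j%:R + - 48))).
  rewrite !binsumD !binsumZ binsum_absorb3 binsum_absorb2 binsum_id !binsum_const.
  by rewrite k2 k3 k4 !exprS; ring.
apply: ler_binsum => j.
(* The polynomial is [2 (j - 2) (j - 3) (j - 4)], negative at 0 and 1, where the other side is 0;
   from 2 on both sides agree. *)
case: (eq01_or_ge2 j) => [/orP [] /eqP -> /=|j2]; rewrite /f.
- by lra.
- by lra.
rewrite le_eqVlt; apply/orP; left; apply/eqP.
by field; rewrite ?unfold_in /=; do ?[apply/andP; split]; apply/eqP; lra.
Qed.

Lemma sum_cover_weight k :
  bsum k.+2 cover_weight <=
    2 ^+ k.+3 / (k.+3%:R + 1) * (1 + 26 / (k.+3%:R * (k.+3%:R - 1))).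
Proof.
rewrite (bsum_flips k.+1 (fun d => weight R (count id d).+1 (adj d))).
pose f (j : nat) : R := j%:R^-1 + slope R j * ((j - 2)%:R / j%:R).
rewrite (@eq_bsum _ k.+1 _ (fun d => f (count id d).+1 +
  (adj d)%:R * (- slope R (count id d).+1))); last first.
  by move=> d; rewrite /weight /f; ring.
rewrite bsumD (@bsum_count _ _ (fun j => f j.+1)) (bsum_adj k (fun j => - slope R j.+1)).
have k0 : 0 <= k%:R :> R by [].
have k2 : k.+2%:R = k%:R + 2 :> R by rewrite addrC -natrD.
have k3 : k.+3%:R = k%:R + 3 :> R by rewrite addrC -natrD.
(* After absorption the summand is [j * f j], equal to [1 + 2 / ((j + 2) (j + 3))] from [j = 3] on.
   The last two terms correct [j = 0] and [j = 1]; [j = 2] leaves a slack of 1 / 10. *)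
have Hf : (k%:R + 2) * binsum k.+1 (fun j => f j.+1) <=
   4 * 2 ^+ k + binsum k.+2 (fun j => 2 / ((j%:R + 2) * (j%:R + 3))) - 4 / 3 - (k%:R + 2) / 6.
  rewrite -k2 -binsum_absorb.
  have -> : 4 * 2 ^+ k + binsum k.+2 (fun j => 2 / ((j%:R + 2) * (j%:R + 3))) - 4 / 3 - k.+2%:R / 6
   = binsum k.+2 (fun j => 1 + (2 / ((j%:R + 2) * (j%:R + 3)) +
       (- (4 / 3) * (j == 0%N)%:R + - (1 / 6) * (j == 1%N)%:R))).
    by rewrite !binsumD !binsumZ binsum_eq0 binsum_eq1 binsum_const !exprS; field.
  apply: ler_binsum => -[|[|[|j]]]; rewrite /f.
  - have -> : 2 / ((0%:R + 2) * (0%:R + 3)) = 1 / 3 :> R by field.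
    by rewrite /=; lra.
  - have -> : 2 / ((1%:R + 2) * (1%:R + 3)) = 1 / 6 :> R by field.
    by rewrite slope_le2//=; lra.
  - have -> : 2 / ((2%:R + 2) * (2%:R + 3)) = 1 / 10 :> R by field.
    by rewrite slope_le2//=; lra.
  rewrite slope_add3 !subSS !subn0 /= -[j.+3]addn3 -[j.+1]addn1 !natrD.
  have j0 : 0 <= j%:R :> R by [].
  rewrite le_eqVlt; apply/orP; left; apply/eqP.
  by field; rewrite ?unfold_in /=; do ?[apply/andP; split]; apply/eqP; lra.
(* Cancelling [j] in the slope fails only at [j = 0], where the fraction is 1 / 10 instead of 0. *)
have -> : binsum k (fun j => j%:R * - slope R j.+2) =
   1 / 10 - binsum k (fun j => 2 / ((j%:R + 4) * (j%:R + 5))).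
  rewrite [RHS](_ : _ = binsum k (fun j => 1 / 10 * (j == 0%N)%:R
      + -1 * (2 / ((j%:R + 4) * (j%:R + 5))))); last first.
    by rewrite binsumD !binsumZ binsum_eq0; ring.
  apply: eq_binsum => -[|j] /=; first by rewrite mul0r; field.
  rewrite slope_add3 -[j.+1]addn1 natrD.
  have j0 : 0 <= j%:R :> R by [].
  by field; rewrite ?unfold_in /=; do ?[apply/andP; split]; apply/eqP; lra.
have := binsum_inv45 k; have := binsum_inv23 k; move: Hf.
set B1 := binsum k.+1 _; set B2 := binsum k.+2 _; set B3 := binsum k _.
rewrite k3 !exprS.
have p0 : 0 <= 2 ^+ k :> R by apply: exprn_ge0.
set p : R := 2 ^+ k in p0 *; set x : R := k%:R in k0 *.
move=> H1 E2 H3.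
set N1 := (X in _ = X) in E2; set N3 := (X in X <= _) in H3.
have {}E2 : B2 = N1 / ((x + 5) * (x + 4) * (x + 3)).
  by rewrite -E2; field; rewrite ?unfold_in /=; do ?[apply/andP; split]; apply/eqP; lra.
have {}H3 : N3 / ((x + 5) * (x + 4) * (x + 3) * (x + 2) * (x + 1)) <= B3.
  by rewrite ler_pdivrMr 1?mulrC// !mulr_gt0//; lra.
rewrite E2 in H1.
have {}H1 : B1 <= (4 * p + N1 / ((x + 5) * (x + 4) * (x + 3)) - 4 / 3 - (x + 2) / 6) / (x + 2).
  by rewrite ler_pdivlMr 1?mulrC//; lra.
apply: (@le_trans _ _ (2 *
  ((4 * p + N1 / ((x + 5) * (x + 4) * (x + 3)) - 4 / 3 - (x + 2) / 6) / (x + 2)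
   + (1 / 10 - N3 / ((x + 5) * (x + 4) * (x + 3) * (x + 2) * (x + 1)))))).
  by rewrite ler_wpM2l//; apply: lerD => //; rewrite lerD2l lerN2.
rewrite -subr_ge0 /N1 /N3.
set A := (X in 0 <= X).
(* The constant 26 makes the terms of order [2 ^ k / k ^ 3] cancel; the exponential part left is of
   order [2 ^ k / k ^ 4]. *)
have -> : A = 8 * p * (116 * x + 68) / ((x + 1) * (x + 2) * (x + 3) * (x + 4) * (x + 5))
   + 2 * (4 * x ^+ 3 + 48 * x ^+ 2 + 182 * x + 198) / (3 * (x + 2) * (x + 3) * (x + 4) * (x + 5)) + 2 / 15.
  by rewrite /A; field; rewrite ?unfold_in /=; do ?[apply/andP; split]; apply/eqP; lra.
by nonneg.
Qed.

End Total.

(** * Deletions acting on flip sequences *)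

Definition del (i : nat) (x : seq bool) : seq bool := take i x ++ drop i.+1 x.

(** The two flips around a deleted symbol merge into their exclusive or; a deleted last symbol takes
    its single flip with it. *)
Lemma pairmap_addb_del a s i : (i < size s)%N ->
  pairmap addb a (del i s) =
  take i (pairmap addb a s) ++
  (if (i.+1 < size s)%N then
     nth false (pairmap addb a s) i (+) nth false (pairmap addb a s) i.+1
       :: drop i.+2 (pairmap addb a s)
   else [::]).
Proof.
rewrite /del; elim: s a i => [|b s IH] a [|i] //=.
  case: s {IH} => [|c s] //= _; rewrite drop0; congr (_ :: _).
  by case: a; case: b; case: c.
by rewrite !ltnS => /(IH b) ->.
Qed.

Lemma adj_cat p q : adj (p ++ q) = (adj p + adj q + (last false p && head false q))%N.
Proof.
elim: p => [|a p IH] /=; first by rewrite addn0.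
by rewrite IH; case: p {IH} => [|b p] /=; lia.
Qed.

(* Counts the interior runs of length two, [p] and [q] being the two flips
   that precede [d]. *)
Fixpoint gap (p q : bool) (d : seq bool) : nat :=
  if d is c :: d' then ([&& p, ~~ q & c] + gap q c d')%N else 0%N.

(** Charge each adjacent pair and each gap to its final one. No one is charged twice, and after two
    zeros the first one is not charged at all. *)
Lemma adj_gap p q d :
  (adj (q :: d) + gap p q d + [&& ~~ p, ~~ q & 0 < count id d] <= count id d)%N.
Proof.
elim: d p q => [|c d IH] p q; first by case: p; case: q.
by move: (IH q c); case: p; case: q; case: c => /=; lia.
Qed.

Lemma adj_le d : (adj d <= (count id d).+1 - 2)%N.
Proof. by have := adj_gap false false d; rewrite /=; case: (count id d) => /=; lia. Qed.

(** * Feasibility of the weight *)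

Section Feasible.
Variable R : realType.

(** The two inner [nth] read the flips one and two places before [i]: [A] goes to interior runs of
    length one, and [h] is lost at those of length two. *)
Lemma sum_run_bounds p q d (A B h : R) :
  \sum_(i < size d)
    (if nth false d i then
       (if nth false (q :: d) i then A else B - h * (nth false [:: p, q & d] i)%:R)
     else 0)
  = (adj (q :: d))%:R * A + ((count id d)%:R - (adj (q :: d))%:R) * B
    - (gap p q d)%:R * h.
Proof.
elim: d p q => [|c d IH] p q; first by rewrite big_ord0; case: q => /=; ring.
rewrite big_ord_recl [X in _ + X]IH /=.
by case: p; case: q; case: c => /=; rewrite ?natrD /=; ring.
Qed.

Lemma weight_take_last d : (0 < size d)%N ->
  weight R (count id d).+1 (adj d) <=
    weight R (count id (take (size d).-1 d)).+1 (adj (take (size d).-1 d)).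
Proof.
case/lastP: d => // p a _; rewrite size_rcons /= -cats1 take_size_cat //.
rewrite count_cat adj_cat /=; case: a => /=; last by rewrite !addn0 andbF addn0.
rewrite addn1; apply: le_trans (weight_succ _ _ _ _ _) => //; last exact: adj_le.
by apply: le_weight; lia.
Qed.

Lemma weight_behead d : head false d ->
  weight R (count id d).+1 (adj d) <= weight R (count id (behead d)).+1 (adj (behead d)).
Proof.
case: d => // a d /= ->; rewrite add1n.
apply: le_trans (weight_succ _ _ _ _ _) => //; last exact: adj_le.
by apply: le_weight; lia.
Qed.

(** For [a] true two runs vanish and [adj] drops by at least one. For [a] false the flip moves one
    place left, and [adj] grows by one exactly when the run had length two. *)
Lemma weight_merge p a q :
  (if a then weight R ((count id [:: a, true & q] + count id p).+1 - 2)
               (adj (p ++ [:: a, true & q]) - 1)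
   else weight R (count id (p ++ [:: a, true & q])).+1 (adj (p ++ [:: a, true & q]))
        - slope R (count id (p ++ [:: a, true & q])).+1 * (last false p)%:R)
  <= weight R (count id (p ++ a (+) true :: q)).+1 (adj (p ++ a (+) true :: q)).
Proof.
rewrite !count_cat !adj_cat; case: a => /=.
  rewrite (_ : (1 + (1 + count id q) + count id p).+1 - 2 = (count id p + (0 + count id q)).+1)%N; last lia.
  by apply: le_weight; case: (last false p) => /=; lia.
rewrite andbF andbT !addn0 !add0n le_eqVlt; apply/orP; left; apply/eqP.
by rewrite /weight !natrD; ring.
Qed.

Lemma cat_take_nth2 (d : seq bool) j : (j.+1 < size d)%N ->
  d = take j d ++ [:: nth false d j, nth false d j.+1 & drop j.+2 d].
Proof. by move=> jd; rewrite -drop_nth// -drop_nth 1?ltnW// cat_take_drop. Qed.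

Lemma weight_del a s i (d := flips (a :: s)) (r := (count id d).+1) :
  (i < size s)%N -> nth false d i ->
  (if nth false (false :: d) i then weight R (r - 2) (adj d - 1)
   else weight R r (adj d) - slope R r * (nth false [:: false, false & d] i)%:R)
  <= cover_weight R (del i (a :: s)).
Proof.
(* At [i = 0] no earlier flip exists to merge with, and the first flip just disappears. *)
rewrite /cover_weight; case: i => [|j] js dj.
  rewrite mulr0 subr0.
  have -> : flips (del 0 (a :: s)) = behead d.
    by rewrite /del /= drop0 /d; case: (s) => [|b []].
  by apply: weight_behead; move: dj; rewrite /d; case: flips.
have -> : flips (del j.+1 (a :: s)) = take j d ++ nth false d j (+) true :: drop j.+2 d.
  rewrite [LHS](_ : _ = pairmap addb a (del j s)) // pairmap_addb_del ?js 1?ltnW//.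
  by rewrite -/(flips (a :: s)) dj.
have jd : (j.+1 < size d)%N by rewrite size_pairmap.
have := cat_take_nth2 d j jd; rewrite dj.
have -> : nth false [:: false, false & d] j.+1 = last false (take j d).
  case: j {js dj} jd => [|j] jd /=; first by rewrite take0.
  by rewrite (take_nth false) ?last_rcons// 2?ltnW.
rewrite [nth false (false :: d) j.+1]/=.
set p := take j d; set q := drop j.+2 d; set b := nth false d j => dE.
apply: le_trans (weight_merge p b q).
by rewrite /r dE count_cat [(count id p + _)%N]addnC.
Qed.

Lemma weight_del_last a s : (0 < size s)%N ->
  weight R (count id (flips (a :: s))).+1 (adj (flips (a :: s)))
  <= cover_weight R (del (size s) (a :: s)).
Proof.
move=> s0; rewrite /cover_weight.
have -> : flips (del (size s) (a :: s)) = take (size s).-1 (flips (a :: s)).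
  case: s s0 => // b s _ /=.
  rewrite [LHS](_ : _ = pairmap addb a (del (size s) (b :: s)))//.
  by rewrite pairmap_addb_del //= ltnn cats0.
have := weight_take_last (flips (a :: s)).
by rewrite /= size_pairmap; exact.
Qed.

(** One deletion per run, at its last symbol; the final run is not ended by a flip and stands
    apart. *)
Lemma sum_run_deletions a s : (0 < size s)%N ->
  1 <= cover_weight R (del (size s) (a :: s)) +
       \sum_(i < size s) (if nth false (flips (a :: s)) i
                          then cover_weight R (del i (a :: s)) else 0).
Proof.
move=> s0; set d := flips (a :: s).
have sd : size d = size s by rewrite size_pairmap.
set r := (count id d).+1.
have := sum_run_bounds false false d (weight R (r - 2) (adj d - 1)) (weight R r (adj d)) (slope R r).
rewrite sd => E.
apply: (@le_trans _ _ (weight R r (adj d) + \sum_(i < size s)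
    (if nth false d i then
       (if nth false (false :: d) i then weight R (r - 2) (adj d - 1)
        else weight R r (adj d) - slope R r * (nth false [:: false, false & d] i)%:R)
     else 0))); last first.
  apply: lerD; first exact: weight_del_last.
  apply: ler_sum => i _; case: ifP => // di; exact: weight_del.
rewrite {}E /=.
have := adj_gap false false d; rewrite /= add0n.
(* A constant string has [r = 1], outside the range of [weight_cover]; its only deletion has weight
   1. *)
have [c0|c0] := posnP (count id d).
  rewrite c0 addn0 leqn0 addn_eq0 => /andP[/eqP u0 /eqP g0].
  by rewrite /r c0 u0 g0 /weight slope_le2//; lra.
move=> ug.
have := @weight_cover R r (adj d) (gap false false d) (ltac:(rewrite /r; lia)) (ltac:(rewrite /r; lia)).
rewrite /r -[(count id d).+1%:R]natr1; lra.
Qed.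

Lemma size_del n (x : n.-tuple bool) (i : 'I_n) : size (del i x) == (n - 1)%N.
Proof.
rewrite size_cat size_take size_drop size_tuple ltn_ord; have := ltn_ord i; lia.
Qed.

Definition del_tuple n (x : n.-tuple bool) (i : 'I_n) : (n - 1).-tuple bool :=
  Tuple (size_del n x i).

(* Deletions at the ends of distinct runs differ at the earlier of the two positions. *)
Lemma del_neq (x : seq bool) i j : (i < j < size x)%N ->
  nth false x i != nth false x i.+1 -> del i x != del j x.
Proof.
move=> /andP[ij jx]; apply: contra => /eqP E.
have := congr1 (fun t => nth false t i) E; rewrite /del !nth_cat.
rewrite !size_take jx (ltn_trans ij jx) ltnn ij subnn nth_drop addn0 nth_take// => ->.
exact: eqxx.
Qed.

Lemma cover_feasible n (x : n.-tuple bool) : (1 < n)%N ->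
  1 <= \sum_(y : (n - 1).-tuple bool) (deletion_channel x y)%:R * cover_weight R y.
Proof.
case: n x => // n x n0.
case: (tupleP x) => a s {x}.
set x := [tuple of a :: s].
pose run_end (i : 'I_n.+1) := (i == ord_max) || nth false (flips (a :: s)) i.
have cw0 y : 0 <= cover_weight R y by apply: weight_ge0; exact: adj_le.
have ss : size s = n by rewrite size_tuple.
have flipE (i : 'I_n.+1) : i != ord_max -> run_end i -> nth false x i != nth false x i.+1.
  rewrite /run_end => /negPf iM; rewrite iM /=.
  have il : (i < size s)%N.
    by rewrite ss ltn_neqAle -ltnS ltn_ord andbT; apply: contraFN iM => /eqP iE; apply/eqP/val_inj.
  rewrite (nth_pairmap false)//=.
  by case: (nth false (a :: s) i); case: (nth false s i).
have inj : {in [pred i | run_end i] &, injective (del_tuple n.+1 x)}.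
  have key (i j : 'I_n.+1) : (i < j)%N -> run_end i -> del_tuple n.+1 x i != del_tuple n.+1 x j.
    move=> ij ri; rewrite -(inj_eq val_inj) /=; apply: del_neq.
      by rewrite ij size_tuple ltn_ord.
    by apply: flipE => //; rewrite -(inj_eq val_inj) /=; have := ltn_ord j; lia.
  move=> i j ri rj E; apply/val_inj/eqP; rewrite /=.
  case: ltngtP => // ij.
    by have := key _ _ ij ri; rewrite E eqxx.
  by have := key _ _ ij rj; rewrite E eqxx.
(* Distinct run ends give distinct neighbours, so the sum over run ends counts each [y] at most
   once. *)
apply: (@le_trans _ _ (\sum_(y in [set del_tuple n.+1 x i | i in [pred i | run_end i]])
     cover_weight R y)); last first.
  rewrite big_mkcond /=; apply: ler_sum => y _; case: ifP => [/imsetP[i _ ->]|_].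
    rewrite (_ : deletion_channel _ _) ?mul1r//.
    by apply/existsP; exists i.
  exact: mulr_ge0.
have end_max : run_end ord_max by rewrite /run_end eqxx.
rewrite big_imset //= big_mkcond big_ord_recr /= inE end_max addrC.
have := sum_run_deletions a s; rewrite ss => /(_ n0) H.
apply: (le_trans H); rewrite lerD2l; apply: ler_sum => i _.
case: ifP => [di|_]; last by case: ifP.
by rewrite ifT // inE /run_end /= [X in _ || X]di orbT.
Qed.

End Feasible.

Theorem theorem2 (R : realType) (n : nat) (hn : (2 <= n)%N) :
  kappa_star R (@deletion_channel n) <=
    (2 ^+ n / (n%:R + 1)) * (1 + 26 / (n%:R * (n%:R - 1))).
Proof.
have cw0 y : 0 <= cover_weight R y by apply: weight_ge0; exact: adj_le.
apply: (@le_trans _ _ (\sum_(y : (n - 1).-tuple bool) cover_weight R y)).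
  apply: ge_inf; first by exists 0 => _ [z [z0 [_ ->]]]; apply: sumr_ge0.
  exists (fun y : (n - 1).-tuple bool => cover_weight R y); split => //; split => // x.
  exact: cover_feasible.
(* The case [n = 2] is apart: two strings of weight 1, against the bound 56 / 3. *)
rewrite bsumE; case: n hn => [|[|[|k]]]// _; rewrite subSS subn0; last exact: sum_cover_weight.
rewrite /= /cover_weight /weight /= !slope_le2// !mul0r invr1.
have -> : 2 ^+ 2 / (2 + 1) * (1 + 26 / (2 * (2 - 1))) = 56 / 3 :> R by field.
lra.
Qed.
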